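(* For each connected graph $G$ and each edge $e\in E(G)$, $|D(G-e)-D(G)|\leq 2$.
   Context: All graphs are finite and simple. The distinguishing number $D(G)$ of a graph $G$ is the least integer $r$ such that there is a vertex labeling $\phi:V(G)\to\{1,\ldots,r\}$ (not required to be proper) for which the identity is the only automorphism of $G$ preserving all vertex labels. The graph $G-e$ is obtained from $G$ by removing the edge $e$ (keeping all vertices). *)

(* Defs.v *)
From HB Require Import structures.
From mathcomp Require Import all_boot all_order all_algebra all_fingroup.

Set Implicit Arguments.
Unset Strict Implicit.
Unset Printing Implicit Defensive.

Record sgraph := SGraph {
  vertex :> finType;
  adj : rel vertex;
  adj_sym : symmetric adj;
  adj_irrefl : irreflexive adj }.

Definition connected (G : sgraph) : Prop :=
  0 < #|G| /\ forall x y : G, connect (@adj G) x y.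

Definition edges (G : sgraph) : {set {set G}} :=
  [set [set p.1; p.2] | p in [set p : G * G | adj p.1 p.2]].

Section DeleteEdge.

Variables (G : sgraph) (e : {set G}).

Definition del_adj : rel G := fun x y => adj x y && ([set x; y] != e).

Fact del_adj_sym : symmetric del_adj.
Proof. by move=> x y; rewrite /del_adj adj_sym setUC. Qed.

Fact del_adj_irrefl : irreflexive del_adj.
Proof. by move=> x; rewrite /del_adj adj_irrefl. Qed.

Definition del_edge : sgraph := SGraph del_adj_sym del_adj_irrefl.

End DeleteEdge.

Section Distinguishing.

Variable G : sgraph.

Definition automorphism (s : {perm G}) : bool :=
  [forall x, forall y, adj (s x) (s y) == adj x y].

(* The labels 1, ..., r are encoded as 0, ..., r - 1. *)
Definition distinguishing (r : nat) (phi : {ffun G -> 'I_r}) : bool :=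
  [forall s : {perm G},
     automorphism s && [forall x, phi (s x) == phi x] ==> (s == 1%g)].

Definition distinguishable (r : nat) : bool :=
  [exists phi : {ffun G -> 'I_r}, distinguishing phi].

Fact distinguishable_exists : exists r, distinguishable r.
Proof.
exists #|G|; apply/existsP; exists [ffun x => enum_rank x].
apply/forallP => s; apply/implyP => /andP[_ /forallP s_phi].
apply/eqP/permP => x; rewrite perm1; apply: enum_rank_inj.
by have /eqP := s_phi x; rewrite !ffunE.
Qed.

Definition distinguishing_number : nat := ex_minn distinguishable_exists.

End Distinguishing.

(* Main.v *)
Require Import Defs.
From mathcomp Require Import all_boot all_order all_algebra all_fingroup.
From mathcomp Require Import zify.

(** Let [r] labels distinguish one of [G] and [G - e], and give the two ends of
    [e] two fresh labels, one each.  An automorphism of the other graph that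
    preserves the new labels fixes both ends of [e].  It therefore preserves
    the pair [e], so it is an automorphism of the first graph as well; and
    since it also preserves the old labels, it is the identity.  Hence each of
    the two distinguishing numbers exceeds the other by at most 2.

    The argument is symmetric in the two graphs, which have the same vertices
    and agree on every pair other than [e].
    [distinguishing_number_fresh] carries the relabelling, for a set of any
    size, and [automorphism_fixing_pair] the transfer of automorphisms. *)

Set Implicit Arguments.
Unset Strict Implicit.
Unset Printing Implicit Defensive.

Lemma distinguishing_number_le (G : sgraph) (r : nat) :
  distinguishable G r -> distinguishing_number G <= r.
Proof.
by move=> Gr; rewrite /distinguishing_number; case: ex_minnP => m _; apply.
Qed.

Section SameVertices.

Variables (T : finType) (a b : rel T).
Hypotheses (a_sym : symmetric a) (a_irr : irreflexive a).
Hypotheses (b_sym : symmetric b) (b_irr : irreflexive b).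

Let A := SGraph a_sym a_irr.
Let B := SGraph b_sym b_irr.

(** Individualizing the vertices of [W], at the cost of one fresh label for
    each, leaves only the automorphisms of [B] that fix [W] pointwise. *)
Lemma distinguishing_number_fresh (W : {set T}) :
  (forall s : {perm T}, @automorphism B s -> {in W, s =1 id} ->
     @automorphism A s) ->
  distinguishing_number B <= distinguishing_number A + #|W|.
Proof.
move=> autBA; apply: distinguishing_number_le.
rewrite /distinguishing_number.
case: ex_minnP => r /existsP[/= phi /forallP phiP] _.
pose m (x : T) : nat := if x \in W then r + index x (enum W) else phi x.
have m_lt x : m x < r + #|W|.
  rewrite /m; case: ifP => Wx; last exact: ltn_addr.
  by rewrite ltn_add2l cardE index_mem mem_enum.
apply/existsP; exists [ffun x => Ordinal (m_lt x)].
apply/forallP => s; apply/implyP => /andP[s_aut /forallP s_lab].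
have ms x : m (s x) = m x.
  by have /eqP := s_lab x; rewrite !ffunE => /(congr1 val).
have s_fix : {in W, s =1 id}.
  move=> x Wx; have := ms x; rewrite /m Wx; case: ifP => [Wsx | _].
    by move/addnI; apply: (index_inj x); rewrite mem_enum.
  (* an old label is below [r], a fresh one is not *)
  by move=> old_new; have := ltn_ord (phi (s x)); rewrite old_new ltnNge leq_addr.
have s_out x : x \notin W -> s x \notin W.
  by apply: contra => Wsx; rewrite -(perm_inj (s_fix _ Wsx)).
apply: (implyP (phiP s)); rewrite (autBA s s_aut s_fix) /=.
apply/forallP => x; case: (boolP (x \in W)) => Wx; first by rewrite s_fix.
have := ms x; rewrite /m (negPf Wx) (negPf (s_out _ Wx)) => eq_phi.
exact/eqP/val_inj.
Qed.

(** An automorphism [s] of [B] fixing [e] pointwise permutes the pairs other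
    than [e], on which [a] and [b] agree, and does not move the pair [e]. *)
Lemma automorphism_fixing_pair (e : {set T}) (s : {perm T}) :
  (forall x y, [set x; y] != e -> a x y = b x y) ->
  @automorphism B s -> {in e, s =1 id} -> @automorphism A s.
Proof.
move=> ab /forallP s_aut s_fix; apply/forallP => x; apply/forallP => y /=.
have imP : s @: [set x; y] = [set s x; s y] by rewrite imsetU1 imset_set1.
have ime : s @: e = e.
  by rewrite -[RHS]imset_id; apply: eq_in_imset.
case: (eqVneq [set x; y] e) => [xy_e | xy_e].
  by rewrite !s_fix // -xy_e !inE eqxx ?orbT.
have sxy_e : [set s x; s y] != e.
  rewrite -imP -{1}ime; apply: contra xy_e => /eqP.
  by move/(imset_inj (@perm_inj _ s)) => ->.
by rewrite !ab //; have /forallP/(_ y) := s_aut x.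
Qed.

Lemma distinguishing_number_pair (e : {set T}) :
  (forall x y, [set x; y] != e -> a x y = b x y) ->
  distinguishing_number B <= distinguishing_number A + #|e|.
Proof.
move=> ab; apply: distinguishing_number_fresh => s.
exact: automorphism_fixing_pair.
Qed.

End SameVertices.

Theorem theorem2p5 (G : sgraph) (e : {set G}) (hG : connected G)
    (he : e \in edges G) :
  (`|(distinguishing_number (del_edge e))%:Z
     - (distinguishing_number G)%:Z| <= 2%:Z)%R.
Proof.
have e2 : #|e| <= 2.
  by case/imsetP: he => p _ ->; rewrite cards2; case: eqP.
case: G e e2 {hG he} => T a a_sym a_irr e e2.
have ab x y : [set x; y] != e -> a x y = @del_adj (SGraph a_sym a_irr) e x y.
  by rewrite /del_adj /= => ->; rewrite andbT.
have ba x y : [set x; y] != e -> @del_adj (SGraph a_sym a_irr) e x y = a x y.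
  by move/ab.
pose G := SGraph a_sym a_irr.
have le1 : distinguishing_number (del_edge e) <= distinguishing_number G + 2.
  apply: leq_trans (leq_add (leqnn _) e2).
  exact: distinguishing_number_pair ab.
have le2 : distinguishing_number G <= distinguishing_number (del_edge e) + 2.
  apply: leq_trans (leq_add (leqnn _) e2).
  exact: distinguishing_number_pair ba.
move: le1 le2; rewrite -/G.
move: (distinguishing_number _) (distinguishing_number _) => m n; lia.
Qed.
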